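(* Let $R$ be a commutative ring of characteristic zero. Then at least one of the following holds: $R$ has infinitely many maximal subrings up to isomorphism, or $U(R)\cap\mathbb{P}$ is finite.
   Context: All rings are commutative with $1\neq 0$; subrings and homomorphisms are unital. $U(R)$ is the set of units of $R$, and $\mathbb{P}$ is the set of natural prime numbers, regarded as a subset of $R$ via the embedding $\mathbb{Z}\cong\mathbb{Z}\cdot 1_R\subseteq R$. A proper subring $S$ of $R$ is a maximal subring of $R$ if it is maximal with respect to inclusion among the proper subrings of $R$. ''Up to isomorphism'' means that subrings are counted up to ring isomorphism. *)

(* Defs.v *)
From HB Require Import structures.
From mathcomp Require Import all_boot all_order all_algebra.
From mathcomp Require Import boolp classical_sets functions cardinality.

Set Implicit Arguments.
Unset Strict Implicit.
Unset Printing Implicit Defensive.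

Import GRing.Theory.

Local Open Scope classical_set_scope.
Local Open Scope ring_scope.

(* [pchar R] =i pred0 would not do here: it only excludes prime
   characteristics, hence holds for instance in Z/4. *)
Definition char_zero (R : comNzRingType) : Prop :=
  forall n : nat, n%:R = 0 :> R -> n = 0%N.

Definition units (R : comNzRingType) : set R :=
  [set x | exists y : R, x * y = 1].
Arguments units : clear implicits.

Definition primes_in (R : comNzRingType) : set R :=
  [set p%:R | p in [set p : nat | prime p]].
Arguments primes_in : clear implicits.

(* An S : subringClosed R is a boolean predicate on R containing 1 and closed
   under subtraction and multiplication. Under the classical axioms of boolp
   every subset of R is given by a boolean predicate, so these are exactly the
   unital subrings of R. *)
Record subring_sort (R : comNzRingType) (S : subringClosed R) := SubringSort {
  subring_val :> R;
  subring_valP : subring_val \in S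
}.

HB.instance Definition _ (R : comNzRingType) (S : subringClosed R) :=
  [isSub for @subring_val R S].
HB.instance Definition _ (R : comNzRingType) (S : subringClosed R) :=
  [Choice of subring_sort S by <:].
HB.instance Definition _ (R : comNzRingType) (S : subringClosed R) :=
  [SubChoice_isSubComNzRing of subring_sort S by <:].

Definition proper_subring (R : comNzRingType) (S : subringClosed R) : Prop :=
  exists x : R, x \notin S.

Definition maximal_subring (R : comNzRingType) (S : subringClosed R) : Prop :=
  proper_subring S /\
  forall T : subringClosed R,
    proper_subring T -> {subset S <= T} -> {subset T <= S}.

Definition isomorphic_subrings (R : comNzRingType) (S T : subringClosed R) :
    Prop :=
  exists f : {rmorphism subring_sort S -> subring_sort T}, bijective f.

Definition maximal_iso_class (R : comNzRingType) (S : subringClosed R) :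
    set (subringClosed R) :=
  [set T | maximal_subring T /\ isomorphic_subrings S T].

Definition infinitely_many_maximal_subrings_up_to_iso (R : comNzRingType) :
    Prop :=
  infinite_set [set maximal_iso_class S | S in @maximal_subring R].

(* Main.v *)
(* Suppose infinitely many primes are units of R. Dividing by an ideal maximal
   among those that contain no nonzero integer gives a homomorphism f from R to a
   field K of characteristic zero. For a prime p that is a unit of R, the p-adic
   valuation of the rationals extends to a real-valued valuation of K; let V be
   its valuation ring, so that V[1/p] = K and 1/p is not in V. Then S = f^-1(V)
   satisfies S[1/p] = R and does not contain 1/p, so Zorn's lemma gives a maximal
   subring T_p of R above S that does not contain 1/p. But T_p contains 1/q for
   every other prime q that is a unit of R, so the T_p are pairwise
   nonisomorphic. *)
From HB Require Import structures.
Require Import Defs.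
From mathcomp Require Import all_boot all_order all_algebra.
From mathcomp Require Import boolp classical_sets functions cardinality.
From mathcomp Require Import ring_quotient generic_quotient.

Set Implicit Arguments.
Unset Strict Implicit.
Unset Printing Implicit Defensive.

Import GRing.Theory.

Local Open Scope classical_set_scope.
Local Open Scope ring_scope.

(** * Zorn's lemma for sets and for subrings *)

(** Zorn's lemma is applied to the sets whose union with [A0] satisfies [P]. The empty chain is then
    bounded by [A0], so [P] is tested on nonempty chains only. *)
Lemma Zorn_above (T : Type) (P : set (set T)) (A0 : set T) :
  P A0 ->
  (forall F : set (set T), F !=set0 -> F `<=` P -> total_on F subset ->
     P (\bigcup_(X in F) X)) ->
  exists A, [/\ A0 `<=` A, P A & forall B, A `<=` B -> P B -> B `<=` A].
Proof.
move=> PA0 Pchain.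
have [|A [PA Amax]] := @Zorn_bigcup T (fun A => P (A `|` A0)).
  move=> F FP Ftot.
  pose G := [set A0] `|` [set X `|` A0 | X in F].
  have -> : (\bigcup_(X in F) X) `|` A0 = \bigcup_(X in G) X.
    apply/seteqP; split=> x.
      case=> [[X FX Xx]|A0x]; last by exists A0 => //; left.
      by exists (X `|` A0); [right; exists X | left].
    case=> _ [->|[X FX <-]]; first by right.
    by case=> [Xx|]; [left; exists X | right].
  apply: Pchain.
  - by exists A0; left.
  - by move=> _ [->//|[X FX <-]]; apply: FP.
  - move=> _ _ [->|[X FX <-]] [->|[Y FY <-]].
    + by left.
    + by left; apply: subsetUr.
    + by right; apply: subsetUr.
    + by case: (Ftot X Y FX FY) => XY; [left|right]; apply: setSU.
exists (A `|` A0); split=> //.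
move=> B AB PB x Bx; apply: contrapT => Ax.
apply: (Amax B); last by rewrite (setUidl _) // => y A0y; apply: AB; right.
split; first by move=> y Ay; apply: AB; left.
by move=> /(_ x Bx) Ax'; apply: Ax; left.
Qed.

Lemma subringClosed_of_set (R : nzRingType) (A : set R) :
  A 1 -> (forall x y, A x -> A y -> A (x - y)) ->
  (forall x y, A x -> A y -> A (x * y)) ->
  exists S : subringClosed R, forall x, x \in S <-> A x.
Proof.
move=> A1 AB AM; pose P : R -> bool := fun x => `[< A x >].
have P_closed : GRing.subring_closed P.
  split; first exact/asboolP.
  - by move=> x y /asboolP Ax /asboolP Ay; apply/asboolP/AB.
  - by move=> x y /asboolP Ax /asboolP Ay; apply/asboolP/AM.
pose S : subringClosed R :=
  HB.pack_for (subringClosed R) P (GRing.isSubringClosed.Build R P P_closed).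
by exists S => x; split=> /asboolP.
Qed.

(** The union of a nonempty chain of subrings is a subring, so only [Q] has to be checked on
    chains. *)
Lemma Zorn_subring (R : nzRingType) (Q : set (set R)) (S0 : subringClosed R) :
  Q [set` S0] ->
  (forall F : set (set R), F !=set0 -> F `<=` Q -> total_on F subset ->
     Q (\bigcup_(X in F) X)) ->
  exists V : subringClosed R,
    [/\ {subset S0 <= V}, Q [set` V] &
     forall W : subringClosed R,
       {subset V <= W} -> Q [set` W] -> {subset W <= V}].
Proof.
move=> QS0 Qchain.
pose sub (A : set R) := [/\ A 1, forall x y, A x -> A y -> A (x - y) &
  forall x y, A x -> A y -> A (x * y)].
have subS (S : subringClosed R) : sub [set` S].
  split=> [|x y|x y]; [exact: rpred1 | exact: rpredB | exact: rpredM].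
have [||A [S0A [[A1 AB AM] QA] Amax]] :=
    @Zorn_above R (fun A => sub A /\ Q A) [set` S0].
- by split.
- move=> F F0 FP Ftot; split; last first.
    by apply: Qchain => // X FX; case: (FP X FX).
  split.
  + by case: F0 => X FX; exists X => //; case: (FP X FX) => -[].
  + move=> x y [X FX Xx] [Y FY Yy].
    by case: (Ftot X Y FX FY) => XY; [exists Y|exists X] => //;
      [case: (FP Y FY) | case: (FP X FX)] => -[_ SB _] _; apply: SB => //;
      apply: XY.
  + move=> x y [X FX Xx] [Y FY Yy].
    by case: (Ftot X Y FX FY) => XY; [exists Y|exists X] => //;
      [case: (FP Y FY) | case: (FP X FX)] => -[_ _ SM] _; apply: SM => //;
      apply: XY.
have [V VA] := subringClosed_of_set A1 AB AM.
have VAE : [set` V] = A by apply/seteqP; split=> x /VA.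
exists V; split.
- by move=> x /S0A /VA.
- by rewrite VAE.
- move=> W VW QW x Wx; apply/VA.
  by apply: (Amax [set` W]) => // y /VA /VW.
Qed.

(** * Integral elements over a subring of a field *)

Section IntegralPoly.
Variables (K : fieldType) (V : subringClosed K).
Implicit Types (x t : K) (p q : {poly K}).

Notation intV := (integralOver (val : subring_sort V -> K)).

Lemma integral_mem x : x \in V -> intV x.
Proof.
move=> Vx; have := integral_id (val : subring_sort V -> K) (SubringSort Vx).
by [].
Qed.

(** The size bound makes ['X^n - q] monic. With its converse below, this gives integral equations
    solved for their leading power. *)
Lemma integral_pow x q n :
  q \is a polyOver V -> (size q <= n)%N -> x ^+ n = q.[x] -> intV x.
Proof.
move=> Vq qn xnq.
apply: (@integral_root_monic _ _ _ x ('X^n - q)).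
- by rewrite monicE lead_coefDl ?lead_coefXn // size_polyN size_polyXn ltnS.
- by rewrite /root hornerD hornerN hornerXn xnq subrr.
- apply/integral_poly => i; apply: integral_mem.
  by move: i; apply/polyOverP; rewrite rpredB // polyOverXn.
Qed.

Lemma integral_powP x : intV x ->
  exists n q, [/\ q \is a polyOver V, (size q <= n)%N & x ^+ n = q.[x]].
Proof.
case=> p mp /rootP px0.
set r := map_poly _ p in px0.
have mr : r \is monic by apply: monic_map.
pose n := (size r).-1; exists n, ('X^n - r); split.
- rewrite rpredB ?polyOverXn //.
  by apply/polyOverP=> i; rewrite coef_map /=; apply: subring_valP.
- have r0 : r != 0 by apply: monic_neq0.
  apply/leq_sizeP => j rj; rewrite coefB coefXn.
  move: rj; rewrite leq_eqVlt => /orP[/eqP <-|rj].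
    by rewrite eqxx -[r`__]/(lead_coef r) (monicP mr) subrr.
  rewrite gtn_eqF // nth_default ?subrr //.
  by rewrite (polySpred r0).
- by rewrite hornerD hornerN hornerXn px0 subr0.
Qed.

(** The factor [v ^+ n] clears the denominators, as [q] has degree at most [n]. *)
Lemma horner_inv_mem v q n : v \in V -> v != 0 ->
  q \is a polyOver V -> (size q <= n.+1)%N -> v ^+ n * q.[v^-1] \in V.
Proof.
move=> Vv v0 /polyOverP Vq qn.
rewrite (horner_coef_wide _ qn) mulr_sumr rpred_sum // => i _.
rewrite mulrCA rpredM // exprVn.
have -> : v ^+ n / v ^+ i = v ^+ (n - i).
  by rewrite -{1}(subnK (leq_ord i)) exprD mulfK // expf_neq0.
by rewrite rpredX.
Qed.

(** An integral equation of degree n+1 for 1/v, multiplied by v^n, has 1/v on the left and an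
    element of [V] on the right. *)
Lemma integral_inv_mem v : v \in V -> v != 0 -> intV v^-1 -> v^-1 \in V.
Proof.
move=> Vv v0 /integral_powP[[|n] [q [Vq qn vq]]].
  move: qn vq; rewrite leqn0 size_poly_eq0 => /eqP ->.
  by rewrite horner0 expr0 => /eqP; rewrite oner_eq0.
have := horner_inv_mem Vv v0 Vq qn.
by rewrite -vq exprSr mulrA exprVn divff ?mul1r // expf_neq0.
Qed.

(** Powers of [t] are cancelled from p(t) = 0 until the constant term is nonzero; its negative is
    then the required multiple of [t]. *)
Lemma root_mul_const t p :
  p \is a polyOver V -> p != 0 -> p.[t] = 0 -> t != 0 ->
  exists q c, [/\ q \is a polyOver V, c \in V, c != 0 & t * q.[t] = c].
Proof.
move=> + + + t0.
elim/poly_ind: p => [|p c IHp]; first by rewrite eqxx.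
move=> Vpc pc0; rewrite hornerMXaddC => ptc.
have Vp : p \is a polyOver V.
  apply/polyOverP=> i; have := polyOverP Vpc i.+1.
  by rewrite coefD coefMX coefC /= addr0.
have Vc : c \in V.
  by have := polyOverP Vpc 0%N; rewrite coefD coefMX coefC /= add0r.
have [c0|c0] := eqVneq c 0.
  apply: IHp => //.
    by apply: contraNneq pc0 => ->; rewrite c0 mul0r addr0.
  by move/eqP: ptc; rewrite c0 addr0 mulf_eq0 (negPf t0) orbF => /eqP.
exists p, (- c); rewrite rpredN oppr_eq0; split=> //.
by apply/eqP; rewrite mulrC -addr_eq0 ptc.
Qed.

(** With b the leading coefficient and d+1 the degree, multiplying p(t) = 0 by b^d gives a monic
    equation for bt. *)
Lemma integral_lead_coefM t p : p \is a polyOver V -> p != 0 -> p.[t] = 0 ->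
  intV (lead_coef p * t).
Proof.
move=> /polyOverP Vp p0 pt0.
set b := lead_coef p; have Vb : b \in V by apply: Vp.
have : (0 < size p)%N by rewrite lt0n size_poly_eq0.
case sp : (size p) => [//|[|d]] _.
  move/eqP: sp => /size_poly1P[c c0 pc].
  by move: pt0; rewrite pc hornerC => /eqP; rewrite (negPf c0).
apply: (@integral_pow _ (\poly_(i < d.+1) (- (p`_i * b ^+ (d - i)))) d.+1).
- by apply: polyOver_poly => i _; rewrite rpredN rpredM // rpredX.
- exact: size_poly.
rewrite horner_poly.
under eq_bigr => i _.
  have -> : - (p`_i * b ^+ (d - i)) * (b * t) ^+ i = - b ^+ d * (p`_i * t ^+ i).
    have -> : b ^+ d = b ^+ (d - i) * b ^+ i.
      by rewrite -exprD subnK // -ltnS.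
    by rewrite exprMn !mulNr (mulrC p`_i) mulrACA.
  over.
rewrite -mulr_sumr.
have := pt0; rewrite horner_coef sp big_ord_recr /=.
have -> : p`_d.+1 = b by rewrite /b lead_coefE sp.
move/eqP; rewrite addr_eq0 => /eqP ->.
by rewrite mulrNN mulrA -exprSr exprMn.
Qed.

End IntegralPoly.

(* For a subring S containing pi, this says that S[1/pi] is a field different
   from S. *)
Definition pi_adic (K : fieldType) (pi : K) (S : set K) : Prop :=
  ~ S pi^-1 /\
  forall x, S x -> x != 0 -> exists y n, S y /\ x * y = pi ^+ n.

(** * Maximal pi-adic subrings of a field *)

Section MaximalPiAdic.
Variables (K : fieldType) (pi : K) (V : subringClosed K).
Hypothesis Vpi : pi \in V.
Hypothesis VnpiV : pi^-1 \notin V.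
Hypothesis Vdvd : forall x, x \in V -> x != 0 ->
  exists y n, y \in V /\ x * y = pi ^+ n.
Hypothesis Vmax : forall W : subringClosed K, {subset V <= W} ->
  pi_adic pi [set` W] -> {subset W <= V}.
Implicit Types (x y t : K) (f g q : {poly K}).

Notation intV := (integralOver (val : subring_sort V -> K)).

Let pi0 : pi != 0.
Proof. by apply: contraNneq VnpiV => ->; rewrite invr0 rpred0. Qed.

(** Membership in V[1/pi], which [Vdvd] makes a field. *)
Definition in_frac x := exists n, pi ^+ n * x \in V.

Let frac_sub x : x \in V -> in_frac x.
Proof. by exists 0%N; rewrite mul1r. Qed.

Let fracB x y : in_frac x -> in_frac y -> in_frac (x - y).
Proof.
move=> [n xn] [m yn]; exists (n + m)%N.
by rewrite mulrBr {1}addnC !exprD -!mulrA rpredB // rpredM // rpredX.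
Qed.

Let fracM x y : in_frac x -> in_frac y -> in_frac (x * y).
Proof.
by move=> [n xn] [m yn]; exists (n + m)%N; rewrite exprD mulrACA rpredM.
Qed.

Let fracV x : in_frac x -> in_frac x^-1.
Proof.
move=> [n xn]; have [->|x0] := eqVneq x 0.
  by rewrite invr0; apply: frac_sub; rewrite rpred0.
have [|y [m [Vy xy]]] := Vdvd xn; first by rewrite mulf_neq0 // expf_neq0.
by exists m; rewrite -xy mulrAC mulfK // rpredM // rpredX.
Qed.

(** Between V and V[1/pi] the divisibility condition is automatic: if pi^n x lies in V, it divides a
    power of pi, and so does x. *)
Lemma sub_maximal_frac (W : subringClosed K) : {subset V <= W} ->
  (forall x, x \in W -> in_frac x) -> pi^-1 \notin W -> {subset W <= V}.
Proof.
move=> VW Wfrac WnpiV; apply: Vmax => //; split; first exact/negP.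
move=> x Wx x0; have [n xn] := Wfrac x Wx.
have [|y [m [Vy xy]]] := Vdvd xn; first by rewrite mulf_neq0 // expf_neq0.
exists (pi ^+ n * y), m; split; first by rewrite /= rpredM ?rpredX ?VW.
by rewrite -xy mulrCA mulrA.
Qed.

(* Otherwise V[x] would contradict the maximality of V. *)
Lemma frac_notin x : in_frac x -> x \notin V ->
  exists2 q, q \is a polyOver V & pi^-1 = q.[x].
Proof.
move=> xfrac /negP; apply: contra_notP => npi.
have [L LE] := subringClosed_of_set (frac_sub (rpred1 V)) fracB fracM.
have [|||W WE] := @subringClosed_of_set K
    [set y | exists2 q, q \is a polyOver V & y = q.[x]].
- by exists 1; rewrite ?rpred1 ?hornerC.
- move=> _ _ [q Vq ->] [r Vr ->].
  by exists (q - r); rewrite ?rpredB // hornerD hornerN.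
- move=> _ _ [q Vq ->] [r Vr ->].
  by exists (q * r); rewrite ?rpredM // hornerM.
apply: (@sub_maximal_frac W).
- by move=> c Vc; apply/WE; exists c%:P; rewrite ?polyOverC ?hornerC.
- move=> y /WE[q Vq ->]; apply/LE; apply: rpred_horner; last exact/LE.
  by apply: polyOverS Vq => c Vc; apply/LE/frac_sub.
- by apply/negP => /WE.
- by apply/WE; exists 'X; rewrite ?polyOverX ?hornerX.
Qed.

(* The integral closure of V in K is again pi-adic. *)
Lemma integral_maximal x : intV x -> x \in V.
Proof.
have [|||W WE] := @subringClosed_of_set K intV.
- exact: integral1.
- by move=> ? ?; apply: integral_sub.
- by move=> ? ?; apply: integral_mul.
have VW : {subset V <= W} by move=> y Vy; apply/WE/integral_mem.
move=> xint; apply: (Vmax VW); last exact/WE.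
split=> [/WE|y /WE /integral_powP[n [q [Vq qn yq]]] y0].
  by move/(integral_inv_mem Vpi pi0); apply/negP.
(* The integral equation of [y] shows that [y] divides a nonzero element [c] of [V], with cofactor
   r(y); in turn [c] divides a power of [pi]. *)
have [|||r [c [Vr Vc c0 ryc]]] := @root_mul_const _ V y ('X^n - q) _ _ _ y0.
- by rewrite rpredB // polyOverXn.
- by rewrite -size_poly_eq0 size_polyDl ?size_polyXn // size_polyN ltnS.
- by rewrite hornerD hornerN hornerXn yq subrr.
have [z [m [Vz cz]]] := Vdvd Vc c0.
exists (r.[y] * z), m; rewrite mulrA ryc; split=> //=.
rewrite rpredM //; last exact: VW.
apply: rpred_horner; first exact: (polyOverS VW).
exact/WE/(integral_pow Vq qn).
Qed.

(** Let u = 1 - pi s. If 1/u were not in V, then 1/pi would be a polynomial in 1/u over V, so u^n/pi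
    would lie in V for some n. Since u^(n+1)/pi = u^n/pi - u^n s, the exponent descends to 0, which
    contradicts the choice of V. *)
Lemma one_sub_pi_unit s : s \in V -> 1 - pi * s != 0 /\ (1 - pi * s)^-1 \in V.
Proof.
move=> Vs; set u := 1 - pi * s.
have Vu : u \in V by rewrite rpredB ?rpred1 // rpredM.
have u0 : u != 0.
  apply: contraNneq VnpiV => /eqP; rewrite subr_eq0 => /eqP ps.
  by rewrite -[pi^-1]mulr1 ps mulKf.
split=> //; apply: contraT => /(frac_notin (fracV (frac_sub Vu)))[q Vq piq].
have := horner_inv_mem Vu u0 Vq (leqnSn _); rewrite -piq.
elim: (size q) => [|n IHn]; first by rewrite mul1r (negPf VnpiV).
rewrite exprSr -mulrA mulrBl mul1r mulrAC divff // mul1r mulrBr => Vn.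
by apply: IHn; rewrite -(subrK (u ^+ n * s) (_ / _)) rpredD // rpredM // rpredX.
Qed.

(* An equation 1 = pi * q(x) over V has the unit 1 - pi * q`_0 as its term
   of degree 0 in x, so 1/x is integral over V. *)
Lemma valuation x : in_frac x -> x \notin V -> x^-1 \in V.
Proof.
move=> xfrac xnV; have [q Vq piq] := frac_notin xfrac xnV.
have x0 : x != 0 by apply: contraNneq xnV => ->; rewrite rpred0.
have q0 : q != 0.
  by apply: contraNneq VnpiV => q0; rewrite piq q0 horner0 rpred0.
have [u0 Vu] := one_sub_pi_unit (polyOverP Vq 0%N).
set u := 1 - _ in u0 Vu.
set n := (size q).-1; have sq : size q = n.+1 by rewrite [LHS]polySpred.
apply: integral_maximal.
(* Dividing 1 = pi q(x) by x^n and collecting the multiples of x^-n on the left leaves u x^-n there.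
   The other coefficients appear in reverse order. *)
apply: (@integral_pow _ _ _ (\poly_(i < n) (u^-1 * (pi * q`_(n - i)))) n).
- apply: polyOver_poly => i _.
  by rewrite rpredM // rpredM //; apply: (polyOverP Vq).
- exact: size_poly.
apply: (mulfI u0); rewrite horner_poly mulr_sumr.
under eq_bigr => i _ do rewrite -!mulrA mulVKf // mulrA.
have : x^-1 ^+ n = pi * (x^-1 ^+ n * q.[x]) by rewrite -piq mulrCA divff ?mulr1.
rewrite horner_coef sq big_ord_recl /= expr0 mulr1 mulrDr mulrDr => /eqP.
rewrite addrC -subr_eq mulrBl mul1r mulrA (mulrAC pi) => /eqP ->.
rewrite (reindex_inj rev_ord_inj) /= mulr_sumr mulr_sumr.
apply: eq_bigr => i _; rewrite /bump add1n subnSK //.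
rewrite (mulrCA (_ ^+ n)) !mulrA -mulrA; congr (_ * _).
rewrite -{1}(subnK (ltnW (ltn_ord i))) exprD mulrAC -exprMn mulVf //.
by rewrite expr1n mul1r.
Qed.

(** * The maximal ideal of the local ring V *)

(** Zero needs its own clause: its inverse is 0 by convention, which lies in [V]. *)
Definition nonunit x := (x \in V) && ((x == 0) || (x^-1 \notin V)).

Let nonunitM x y : nonunit x -> y \in V -> nonunit (x * y).
Proof.
move=> /andP[Vx xN] Vy; rewrite /nonunit rpredM //=.
have [|/= xy0] := eqVneq (x * y) 0; first by [].
have /andP[x0 y0] : (x != 0) && (y != 0) by rewrite -negb_or -mulf_eq0.
move: xN; rewrite (negPf x0) /=; apply: contraNN => xyV.
have -> : x^-1 = y * (x * y)^-1 by rewrite invfM mulrCA divff ?mulr1.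
exact: rpredM.
Qed.

(** One of y/x and x/y lies in V by [valuation], so the sum is a nonunit times an element of V. *)
Let nonunitD x y : nonunit x -> nonunit y -> nonunit (x + y).
Proof.
wlog : x y / y / x \in V => [hw xN yN|Vyx xN yN].
  have [Vyx|nVyx] := boolP (y / x \in V); first exact: hw.
  have yxfrac : in_frac (y / x).
    by apply: fracM; [|apply: fracV]; apply: frac_sub;
      case/andP: (xN); case/andP: (yN).
  rewrite addrC; apply: hw => //.
  by have := valuation yxfrac nVyx; rewrite invf_div.
have [x0|x0] := eqVneq x 0; first by rewrite x0 add0r.
have -> : x + y = x * (1 + y / x) by rewrite mulrDr mulr1 mulrC divfK.
by apply: nonunitM; rewrite // rpredD ?rpred1.
Qed.

Let nonunitN x : nonunit x -> nonunit (- x).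
Proof. by rewrite /nonunit rpredN oppr_eq0 invrN rpredN. Qed.

Let nonunit0 : nonunit 0.
Proof. by rewrite /nonunit rpred0 eqxx. Qed.

Let nonunit_pi : nonunit pi.
Proof. by rewrite /nonunit Vpi (negPf pi0). Qed.

Let unitM x y : x \in V -> y \in V -> ~~ nonunit x -> ~~ nonunit y ->
  ~~ nonunit (x * y).
Proof.
move=> Vx Vy; rewrite /nonunit !rpredM ?Vx ?Vy //= !negb_or !negbK mulf_eq0.
by move=> /andP[x0 xV] /andP[y0 yV]; rewrite negb_or x0 y0 invfM rpredM.
Qed.

(** * Primitive polynomials and the Gauss valuation *)

(** These are the polynomials over V with nonzero reduction modulo the maximal ideal. *)
Definition primitive f := f \is a polyOver V /\ exists i, ~~ nonunit f`_i.

Let primitive_neq0 f : primitive f -> f != 0.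
Proof.
by case=> _ [i]; apply: contraNneq => ->; rewrite coef0.
Qed.

Lemma primitive1 : primitive 1.
Proof.
split; first exact: rpred1.
by exists 0%N; rewrite coef1 /nonunit invr1 oner_eq0 rpred1.
Qed.

(* Gauss's lemma, for the local ring V. *)
Lemma primitiveM f g : primitive f -> primitive g -> primitive (f * g).
Proof.
move=> [Vf fU] [Vg gU]; split; first exact: rpredM.
have Vfi i := polyOverP Vf i; have Vgi i := polyOverP Vg i.
pose i := ex_minn fU; pose j := ex_minn gU.
have [fi fmin] : ~~ nonunit f`_i /\ forall k, (k < i)%N -> nonunit f`_k.
  rewrite /i; case: ex_minnP => m fm mmin; split=> // k km.
  by apply: contraTT km => /mmin; rewrite leqNgt.
have [gj gmin] : ~~ nonunit g`_j /\ forall k, (k < j)%N -> nonunit g`_k.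
  rewrite /j; case: ex_minnP => m fm mmin; split=> // k km.
  by apply: contraTT km => /mmin; rewrite leqNgt.
(* Here [i] and [j] index the first unit coefficients. Every other term of the coefficient of degree
   i+j has a nonunit factor. *)
exists (i + j)%N; apply: contraTN (unitM (Vfi i) (Vgi j) fi gj) => fgN.
have ij : (i < (i + j).+1)%N by rewrite ltnS leq_addr.
move: fgN; rewrite coefM (bigD1 (Ordinal ij)) //= addKn negbK.
set r := \sum_(_ | _) _ => fgr.
rewrite -(addrK r (f`_i * g`_j)); apply: nonunitD => //.
apply: nonunitN; rewrite /r; elim/big_ind: _ => // k kij.
have [ki|ik] := ltnP k i; first by apply: nonunitM => //; apply: fmin.
rewrite mulrC; apply: nonunitM => //; apply: gmin.
have ik' : (i < k)%N.
  rewrite ltn_neqAle ik andbT; apply: contraNneq kij => ik'.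
  exact/eqP/val_inj.
by rewrite ltn_subLR ?ltn_add2r // -ltnS.
Qed.

(* Divide by a coefficient of least valuation. *)
Lemma primitive_scale f : (forall i, in_frac f`_i) -> f != 0 ->
  exists c, [/\ c != 0, in_frac c & primitive (c *: f)].
Proof.
move=> ffrac f0.
have [a [a0 afrac [i ai] fa]] : exists a,
    [/\ a != 0, in_frac a, exists i, a = f`_i & forall i, f`_i / a \in V].
  suff [a [a0 fa ai]] : exists a, [/\ a != 0, a \in (f : seq K) &
     forall b, b \in (f : seq K) -> b / a \in V].
    have [i _ fi] := nthP 0 fa; exists a; split=> //; first by rewrite -fi.
      by exists i.
    move=> k; have [kf|fk] := ltnP k (size f); first by apply/ai/mem_nth.
    by rewrite nth_default // mul0r rpred0.
  have : forall b, b \in (f : seq K) -> in_frac b.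
    by move=> b /(nthP 0)[i _ <-].
  have : has (fun b => b != 0) (f : seq K).
    apply/hasP; exists (lead_coef f); rewrite ?lead_coef_eq0 //.
    by apply: mem_nth; rewrite polySpred.
  (* The best coefficient [a] of the tail is replaced by the head [b] exactly when b/a is not in V;
     then a/b is, by [valuation]. *)
  elim: (f : seq K) => [//|b s IHs] /= bs0 bsfrac.
  have sfrac c : c \in s -> in_frac c.
    by move=> cs; apply: bsfrac; rewrite inE cs orbT.
  have [s0|sall0] := boolP (has (fun b => b != 0) s); last first.
    move: bs0; rewrite (negPf sall0) orbF => b0; exists b; split=> //.
      by rewrite mem_head.
    move=> c; rewrite inE => /predU1P[->|cs]; first by rewrite divff ?rpred1.
    by move/hasPn: sall0 => /(_ c cs) /negPn/eqP ->; rewrite mul0r rpred0.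
  have [a [a0 sa aP]] := IHs s0 sfrac.
  have [Vba|nVba] := boolP (b / a \in V).
    exists a; split=> //; first by rewrite inE sa orbT.
    by move=> c; rewrite inE => /predU1P[->//|/aP].
  have b0 : b != 0 by apply: contraNneq nVba => ->; rewrite mul0r rpred0.
  exists b; split; rewrite ?mem_head // => c.
  rewrite inE => /predU1P[->|/aP ca]; first by rewrite divff ?rpred1.
  have -> : c / b = c / a * (b / a)^-1 by rewrite invf_div mulrA divfK.
  rewrite rpredM // valuation //.
  by apply: fracM; [apply: bsfrac; rewrite mem_head|apply/fracV/sfrac].
exists a^-1; split; rewrite ?invr_eq0 //; first exact: fracV.
split; first by apply/polyOverP=> k; rewrite coefZ mulrC.
by exists i; rewrite coefZ -ai mulVf // /nonunit rpred1 oner_eq0 invr1 rpred1.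
Qed.

(* The fractions f(t) / g(t) with g primitive form the ring of the Gauss
   valuation, which extends V to the field generated by t. *)
Lemma transcendental_in t : (forall g, primitive g -> g.[t] != 0) -> t \in V.
Proof.
move=> tT.
have [|||W WE] := @subringClosed_of_set K [set y | exists f g,
    [/\ f \is a polyOver V, primitive g & y = f.[t] / g.[t]]].
- by exists 1, 1; split; rewrite ?rpred1 ?hornerC ?divr1 //; apply: primitive1.
- move=> _ _ [f [g [Vf pg ->]]] [h [k [Vh pk ->]]].
  exists (f * k - h * g), (g * k); split; last 1 first.
  + rewrite -mulNr addf_div ?tT // -hornerM.
    by rewrite hornerD hornerN !hornerM mulNr.
  + by case: pg pk => Vg _ [Vk _]; rewrite rpredB // rpredM.
  + exact: primitiveM.
- move=> _ _ [f [g [Vf pg ->]]] [h [k [Vh pk ->]]].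
  exists (f * h), (g * k); split; [exact: rpredM|exact: primitiveM|].
  by rewrite !hornerM mulf_div.
have VW : {subset V <= W}.
  move=> c Vc; apply/WE; exists c%:P, 1; split; rewrite ?polyOverC //.
    exact: primitive1.
  by rewrite !hornerC divr1.
have Wt : t \in W.
  apply/WE; exists 'X, 1; split; rewrite ?polyOverX //.
    exact: primitive1.
  by rewrite hornerX hornerC divr1.
apply: (Vmax VW) => //; split=> /=.
  move=> /WE[f [g [Vf pg fg]]].
  (* If 1/pi = f(t)/g(t), then t is a root of g - pi f, which is primitive because pi is a
     nonunit. *)
  have /tT/eqP[] : primitive (g - pi *: f).
    case: (pg) => Vg [i gi]; split; first by rewrite rpredB // polyOverZ.
    exists i; apply: contraNN gi; rewrite coefB coefZ => gfi.
    rewrite -(subrK (pi * f`_i) g`_i); apply: nonunitD => //.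
    by apply: nonunitM => //; apply: (polyOverP Vf).
  rewrite hornerD hornerN hornerZ.
  have -> : f.[t] = pi^-1 * g.[t] by rewrite fg divfK // tT.
  by rewrite mulVKf // subrr.
move=> x /WE[f [g [Vf pg ->]]] fg0.
have f0 : f != 0 by apply: contraNneq fg0 => ->; rewrite horner0 mul0r.
(* Once cf is primitive, g(t)/(cf)(t) lies in W, and its product with f(t)/g(t) is 1/c. A power of
   pi times 1/c lies in V and divides a power of pi. *)
have [i|c [c0 cfrac cf]] := primitive_scale _ f0.
  by apply/frac_sub/(polyOverP Vf).
have [n Vc] := fracV cfrac.
have [|y [m [Vy cy]]] := Vdvd Vc.
  by rewrite mulf_neq0 ?invr_eq0 ?expf_neq0.
exists (g.[t] / (c *: f).[t] * (pi ^+ n * y)), m; split.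
  apply: rpredM; last by rewrite VW // rpredM // rpredX.
  by apply/WE; exists g, (c *: f); split=> //; case: pg.
have ft0 : f.[t] != 0.
  by have := tT _ cf; rewrite hornerZ mulf_eq0 negb_or => /andP[].
rewrite -cy hornerZ mulrA (mulrA (f.[t] / _)) divfK ?tT //.
by rewrite invfM (mulrCA f.[t]) divff // mulr1 mulrCA mulrA.
Qed.

(** The leading coefficient b of g makes bt integral, hence an element of V, and b divides a power
    of pi. *)
Lemma algebraic_frac t g : primitive g -> g.[t] = 0 -> in_frac t.
Proof.
move=> pg gt0; have [Vg _] := pg; have g0 := primitive_neq0 pg.
have Vb : lead_coef g \in V by apply: (polyOverP Vg).
have [|c [n [Vc bc]]] := Vdvd Vb; first by rewrite lead_coef_eq0.
exists n; rewrite -bc mulrAC rpredM //.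
exact/integral_maximal/integral_lead_coefM.
Qed.

Lemma maximal_frac t : in_frac t.
Proof.
have [[g pg gt0]|tT] := pselect (exists2 g, primitive g & g.[t] = 0).
  exact: algebraic_frac pg gt0.
apply/frac_sub/transcendental_in => g pg.
by apply/eqP => gt0; apply: tT; exists g.
Qed.

End MaximalPiAdic.

(** This stands in for the extension of a valuation to K: V is maximal among the pi-adic subrings
    above A, a property that passes to unions of nonempty chains. *)
Lemma pi_adic_extension (K : fieldType) (pi : K) (A : subringClosed K) :
  pi \in A -> pi_adic pi [set` A] ->
  exists V : subringClosed K,
    [/\ {subset A <= V}, pi^-1 \notin V &
     forall x, exists n, pi ^+ n * x \in V].
Proof.
move=> Api Aadic.
have [F [X0 FX0] Fadic Ftot|V [AV [VnpiV Vdvd] Vmax]] := Zorn_subring Aadic.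
  split; first by case=> X FX; case: (Fadic X FX).
  move=> x [X FX Xx] x0; have [_ /(_ x Xx x0)[y [n [Xy xy]]]] := Fadic X FX.
  by exists y, n; split=> //; exists X.
exists V; split=> //; first exact/negP.
by move=> x; apply: maximal_frac => //; [apply: AV | apply/negP].
Qed.

(** * The integers localized at a prime *)

Definition Z_at (K : fieldType) (p : nat) : set K :=
  [set x | exists (a : int) (b : nat), coprime p b /\ x * b%:R = a%:~R].

Section Z_at.
Variables (K : fieldType) (p : nat).
Hypothesis K0 : char_zero K.
Hypothesis pp : prime p.

Let natK_eq0 n : (n%:R == 0 :> K) = (n == 0)%N.
Proof. by apply/eqP/eqP=> [/K0|->]. Qed.

Let intK_eq0 (a : int) : (a%:~R == 0 :> K) = (a == 0).
Proof.
case: a => n; first by rewrite -pmulrn natK_eq0.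
by rewrite NegzE mulrNz -pmulrn oppr_eq0 natK_eq0.
Qed.

Let coprime_neq0 b : coprime p b -> (b%:R : K) != 0.
Proof.
rewrite natK_eq0; apply: contraTneq => ->.
by rewrite /coprime gcdn0 gtn_eqF // prime_gt1.
Qed.

Lemma Z_at_subring : exists A : subringClosed K, forall x, x \in A <-> Z_at p x.
Proof.
apply: subringClosed_of_set.
- by exists 1, 1%N; rewrite coprimen1 mulr1.
- move=> x y [a [b [pb xb]]] [c [d [pd yd]]].
  exists (a * d%:Z - c * b%:Z), (b * d)%N; rewrite coprimeMr pb pd; split=> //.
  by rewrite natrM rmorphB !rmorphM /= -xb -yd mulrBl mulrA (mulrAC y) mulrA.
- move=> x y [a [b [pb xb]]] [c [d [pd yd]]].
  exists (a * c), (b * d)%N; rewrite coprimeMr pb pd; split=> //.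
  by rewrite natrM rmorphM /= -xb -yd mulrACA.
Qed.

Lemma Z_at_prime_inv q : prime q -> q != p -> Z_at p (q%:R^-1 : K).
Proof.
move=> qp qnp; have pq : coprime p q.
  by rewrite prime_coprime // dvdn_prime2 // eq_sym.
by exists 1, q; split=> //; rewrite mulVf // coprime_neq0.
Qed.

Lemma Z_at_pi_adic : pi_adic (p%:R : K) (Z_at p).
Proof.
have p0 : (p%:R : K) != 0 by rewrite natK_eq0 -lt0n prime_gt0.
split.
  case=> a [b [pb /(congr1 ( *%R p%:R))]]; rewrite mulVKf // => /eqP.
  rewrite [b%:R]pmulrn [p%:R]pmulrn -intrM -subr_eq0 -intrB intK_eq0 subr_eq0.
  move=> /eqP ba; move: pb; rewrite prime_coprime // => /negP; apply.
  by rewrite -[p]/`|p%:Z|%N -[b]/`|b%:Z|%N ba abszM dvdn_mulr.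
move=> x [a [b [pb xb]]] x0.
have b0 := coprime_neq0 pb.
have a0 : (0 < `|a|)%N.
  by rewrite absz_gt0 -intK_eq0 -xb mulf_neq0.
(* Write |a| = m p^n with m prime to p. Then x is p^n m/b up to sign, so b/m with the sign of a is
   the cofactor. *)
have [m pm am] := pfactor_coprime pp a0.
have m0 := coprime_neq0 pm.
set n := logn p _ in am.
exists ((-1) ^+ (a < 0)%R * b%:R / m%:R), n; split.
  exists ((-1) ^+ (a < 0)%R * b%:Z), m; split=> //.
  by rewrite divfK // rmorphM rmorph_sign.
have -> : x * ((-1) ^+ (a < 0)%R * b%:R / m%:R) =
    (-1) ^+ (a < 0)%R * (x * b%:R) / m%:R.
  by rewrite mulrA mulrCA.
rewrite xb {2}[a]intEsign rmorphM rmorph_sign signrMK /= -pmulrn am.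
by rewrite natrM natrX mulrAC mulfV // mul1r.
Qed.

End Z_at.

(** * Homomorphisms to a field of characteristic zero *)

(** Classical choice supplies the inverse, the identity on nonunits, that makes [D] an
    [idomainType]; its field of fractions can then be formed. *)
Lemma fraction_field (D : comNzRingType) :
  (forall x y : D, x * y = 0 -> x = 0 \/ y = 0) ->
  exists (K : fieldType) (f : {rmorphism D -> K}), injective f.
Proof.
move=> D_dom.
pose unit : pred D := fun x => `[< exists y, y * x = 1 >].
pose inv (x : D) : D := if pselect (exists y, y * x = 1) is left e
  then projT1 (cid e) else x.
have mulVx : {in unit, left_inverse 1 inv *%R}.
  move=> x /asboolP xU; rewrite /inv; case: pselect => // e.
  by case: (cid e).
have unitPl x y : y * x = 1 -> unit x by move=> yx; apply/asboolP; exists y.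
have inv_out : {in [predC unit], inv =1 id}.
  by move=> x /asboolP xU; rewrite /inv; case: pselect.
pose Du : comUnitRingType := HB.pack_for comUnitRingType D
  (GRing.ComNzRing_hasMulInverse.Build D mulVx unitPl inv_out).
have D_integral : GRing.integral_domain_axiom Du.
  by move=> x y /D_dom[] ->; rewrite eqxx ?orbT.
pose Di : idomainType := HB.pack_for idomainType Du
  (GRing.ComUnitRing_isIntegral.Build Du D_integral).
pose f : D -> {fraction Di} := @FracField.tofrac Di.
pose fM : {rmorphism D -> {fraction Di}} :=
  HB.pack_for {rmorphism D -> {fraction Di}} f
    (GRing.isZmodMorphism.Build D {fraction Di} f (@tofrac_is_zmod_morphism Di))
    (GRing.isMonoidMorphism.Build D {fraction Di} f
       (@tofrac_is_monoid_morphism Di)).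
exists {fraction Di}, fM.
by move=> x y /eqP; rewrite tofrac_eq => /eqP.
Qed.

(** An ideal maximal among those disjoint from a multiplicative set, here the nonzero integers, is
    prime. *)
Lemma char_zero_prime_quotient (R : comNzRingType) : char_zero R ->
  exists (D : comNzRingType) (f : {rmorphism R -> D}),
    char_zero D /\ (forall x y : D, x * y = 0 -> x = 0 \/ y = 0).
Proof.
move=> R0.
pose ideal (I : set R) := [/\ I 0, forall x y, I x -> I y -> I (x - y) &
  forall a x, I x -> I (a * x)].
pose avoidsZ (I : set R) := forall n : nat, I n%:R -> n = 0%N.
have [||I [_ [[I0 IB IM] IZ] Imax]] :=
    @Zorn_above R (fun I => ideal I /\ avoidsZ I) [set 0].
- split; last by move=> n /= /R0.
  by split=> //= [x y -> ->|a x ->]; rewrite ?subrr ?mulr0.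
- move=> F F0 FP Ftot; split; last first.
    by move=> n [X FX]; case: (FP X FX) => _ /(_ n).
  split.
  + by case: F0 => X FX; exists X => //; case: (FP X FX) => -[].
  + move=> x y [X FX Xx] [Y FY Yy].
    by case: (Ftot X Y FX FY) => XY; [exists Y|exists X] => //;
      [case: (FP Y FY) | case: (FP X FX)] => -[_ SB _] _; apply: SB => //;
      apply: XY.
  + move=> a x [X FX Xx]; exists X => //.
    by case: (FP X FX) => -[_ _ SM] _; apply: SM.
have Iprime x y : I (x * y) -> I x \/ I y.
  move=> Ixy; apply: contrapT => /not_orP[nIx nIy].
  (* By maximality, the ideal I + Rz contains a nonzero integer. *)
  have meet z : ~ I z -> exists n a, n != 0%N /\ I (n%:R - a * z).
    move=> nIz; apply: contrapT => nex; apply: nIz.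
    pose J := [set u | exists a, I (u - a * z)].
    apply: (Imax J).
    - by move=> u Iu; exists 0; rewrite mul0r subr0.
    - split; last first.
        move=> n [a na]; apply/eqP; apply: contra_notT nex => n0.
        by exists n, a.
      split.
      + by exists 0; rewrite mul0r subr0.
      + move=> u v [a ua] [b vb]; exists (a - b).
        have -> : u - v - (a - b) * z = u - a * z - (v - b * z).
          by rewrite mulrBl !opprD !opprK addrACA.
        exact: IB.
      + by move=> c u [a ua]; exists (c * a); rewrite -mulrA -mulrBr; apply: IM.
    - by exists 1; rewrite mul1r subrr.
  have [n [a [n0 na]]] := meet x nIx; have [m [b [m0 mb]]] := meet y nIy.
  have : I (n * m)%:R.
    have ID u v : I u -> I v -> I (u + v).
      move=> Iu Iv; rewrite -[v]opprK -[- v]sub0r; by do 2?apply: (IB).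
    (* Modulo I, n = ax and m = by, so nm = abxy = 0. *)
    have -> : (n * m)%:R = m%:R * (n%:R - a * x) + (a * x * (m%:R - b * y) +
        a * b * (x * y)).
      rewrite natrM !mulrBr.
      rewrite [a * x * (b * y)]mulrACA addrNK (mulrC m%:R n%:R).
      by rewrite (mulrC m%:R (a * x)) subrK.
    apply: (ID); first exact: IM.
    by apply: (ID); exact: IM.
  by move/IZ/eqP; rewrite muln_eq0 (negPf n0) (negPf m0).
pose P : R -> bool := fun x => `[< I x >].
have P_closed : idealr_closed P.
  split; first exact/asboolP.
  - by apply/asboolP => /(IZ 1%N).
  - move=> a x y /asboolP Ix /asboolP Iy; apply/asboolP.
    rewrite -[y]opprK -[- y]sub0r; apply: (IB); [exact: IM | exact: IB].
pose PI : idealr R := HB.pack_for (idealr R) P (isIdealr.Build R P P_closed).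
pose Q := {ideal_quot PI}; pose f : {rmorphism R -> Q} := \pi_Q%qT.
have fI x : f x = 0 -> I x.
  move=> fx0; apply/asboolP; change (x \in PI).
  rewrite -[x]subr0 Quotient.idealrBE; apply/eqP.
  by rewrite -[LHS]/(f x) fx0 rmorph0.
have If x : I x -> f x = 0.
  move=> Ix; have : x - 0 \in PI by rewrite subr0; apply/asboolP.
  by rewrite Quotient.idealrBE => /eqP; rewrite -[LHS]/(f x) -/Q rmorph0.
exists Q, f; split=> [n n0|x y].
  by apply/IZ/fI; rewrite rmorph_nat.
by rewrite -[x]reprK -[y]reprK -!/(f _) -rmorphM => /fI/Iprime[]/If;
  [left|right].
Qed.

Lemma char_zero_to_field (R : comNzRingType) : char_zero R ->
  exists (K : fieldType) (f : {rmorphism R -> K}), char_zero K.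
Proof.
move=> /char_zero_prime_quotient[D [f [D0 /fraction_field[K [g g_inj]]]]].
exists K, (g \o f : {rmorphism R -> K}) => n n0.
by apply: D0; apply: g_inj; rewrite rmorph_nat rmorph0.
Qed.

(** * Maximal subrings that omit the inverse of one prime *)

(** Let T be maximal among the subrings above S without u. A subring above T that contains u
    contains every x = u^n (v^n x), so it is R. *)
Lemma maximal_subring_exists (R : comNzRingType) (S : subringClosed R)
    (u v : R) :
  v * u = 1 -> v \in S -> u \notin S ->
  (forall x, exists n, v ^+ n * x \in S) ->
  exists T : subringClosed R,
    [/\ {subset S <= T}, maximal_subring T & u \notin T].
Proof.
move=> vu Sv Su Sx.
have [|F _ FP _ [X FX]|T [ST Tu Tmax]] := @Zorn_subring R (fun A => ~ A u) S.
- exact/negP.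
- exact: FP.
exists T; split=> //; last exact/negP.
split; first by exists u; apply/negP.
move=> W [x xW] TW; apply: Tmax => //= Wu; case/negP: xW.
have [n vx] := Sx x.
have -> : x = u ^+ n * (v ^+ n * x).
  by rewrite mulrA -exprMn [u * v]mulrC vu expr1n mul1r.
by rewrite rpredM ?rpredX //; apply/TW/ST.
Qed.

(** T lies above the preimage of V, which contains 1/q for q different from p because V contains the
    integers localized at p. *)
Lemma prime_separating_maximal_subring (R : comNzRingType) (p : nat) (u : R) :
  char_zero R -> prime p -> p%:R * u = 1 ->
  exists T : subringClosed R, [/\ maximal_subring T, u \notin T &
    forall q (w : R), prime q -> q != p -> q%:R * w = 1 -> w \in T].
Proof.
move=> /char_zero_to_field[K [f K0]] pp pu.
have [A AE] := Z_at_subring K p.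
have AZ : [set` A] = Z_at p by apply/seteqP; split=> x /AE.
have [||V [AV VnpV Vfrac]] := @pi_adic_extension K p%:R A.
- by rewrite rpred_nat.
- by rewrite AZ; apply: Z_at_pi_adic.
have [|||S SE] := @subringClosed_of_set R [set x | f x \in V].
- by rewrite /= rmorph1 rpred1.
- by move=> x y /= Vx Vy; rewrite rmorphB rpredB.
- by move=> x y /= Vx Vy; rewrite rmorphM rpredM.
have fV n w : n%:R * w = 1 -> f w = n%:R^-1.
  move=> nw; have fnw : n%:R * f w = 1.
    by rewrite -(rmorph_nat f) -rmorphM nw rmorph1.
  by apply: (@mulfI _ n%:R); rewrite ?divff // ?fnw //;
     apply: contra_eq_neq fnw => ->; rewrite mul0r eq_sym oner_eq0.
have [||x|T [ST Tmax Tu]] := @maximal_subring_exists R S u p%:R pu.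
- by rewrite rpred_nat.
- by apply/negP => /SE /=; apply/negP; rewrite (fV _ _ pu).
- have [n Vx] := Vfrac (f x); exists n; apply/SE.
  by rewrite /= rmorphM rmorphXn rmorph_nat.
exists T; split=> // q w qp qnp qw; apply/ST/SE; rewrite /= (fV _ _ qw).
by apply/AV/AE/Z_at_prime_inv.
Qed.

(** * Isomorphism classes and the theorem *)

Lemma isomorphic_subrings_refl (R : comNzRingType) (S : subringClosed R) :
  isomorphic_subrings S S.
Proof. by exists idfun; exists idfun. Qed.

(** A ring homomorphism sends an inverse of n to an inverse of n, and inverses are unique in R. *)
Lemma isomorphic_subrings_nat_inv (R : comNzRingType) (S T : subringClosed R)
    (n : nat) (u : R) :
  isomorphic_subrings S T -> n%:R * u = 1 -> u \in S -> u \in T.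
Proof.
move=> [f _] nu Su; pose us := SubringSort Su.
have nus : n%:R * us = 1 by apply: val_inj; rewrite rmorphM rmorph_nat rmorph1.
have nfu : n%:R * val (f us) = 1.
  have : val (f (n%:R * us)) = 1 by rewrite nus !rmorph1.
  by rewrite !rmorphM !rmorph_nat.
have -> : u = val (f us); last exact: subring_valP.
by rewrite -[LHS]mul1r -nfu mulrAC nu mul1r.
Qed.

Theorem theorem3p11 (R : comNzRingType) (hR : char_zero R) :
  infinitely_many_maximal_subrings_up_to_iso R \/
  finite_set (units R `&` primes_in R).
Proof.
have [fin|inf] := pselect (finite_set (units R `&` primes_in R)).
  by right.
left=> fin_classes; apply: inf.
pose P := [set p : nat | prime p /\ exists u : R, p%:R * u = 1].
suff finP : finite_set P.
  apply: sub_finite_set (finite_image (fun p => p%:R : R) finP).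
  move=> x [[u xu] [p pp px]]; exists p => //; split=> //.
  by exists u; rewrite px.
have PT p : exists T : subringClosed R, P p -> maximal_subring T /\
    forall q (w : R), prime q -> q%:R * w = 1 -> (w \in T) = (q != p).
  have [[pp [u pu]]|nPp] := pselect (P p); last first.
    (* Outside P the ring R itself serves as a default, so that choice yields a total function. *)
    have [T _] := @subringClosed_of_set R setT I
      (fun _ _ _ _ => I) (fun _ _ _ _ => I).
    by exists T.
  have [T [Tmax Tu Tw]] := prime_separating_maximal_subring hR pp pu.
  exists T => _; split=> // q w qp qw.
  have [qE|/Tw] := eqVneq q p; last exact.
  suff -> : w = u by apply: negbTE.
  by rewrite -[w]mulr1 -pu mulrCA -qE mulrA qw mul1r.
have [T TP] := choice PT.
have Tinj : {in P &, injective (fun p => maximal_iso_class (T p))}.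
  move=> p q; rewrite !inE => Pp Pq Tpq.
  have [Tpmax Tpw] := TP p Pp; have [Tqmax Tqw] := TP q Pq.
  (* Equal classes make T_p and T_q isomorphic. If q differed from p, then 1/q would lie in T_p and
     hence in T_q, which omits it. *)
  have : maximal_iso_class (T q) (T q).
    by split=> //; apply: isomorphic_subrings_refl.
  rewrite -Tpq => -[_ Tiso].
  case: (Pq) => qp [w qw]; have := isomorphic_subrings_nat_inv Tiso qw.
  rewrite (Tpw q w qp qw) (Tqw q w qp qw) eqxx.
  by have [//|_ /(_ isT)] := eqVneq q p.
rewrite -(eq_finite_set (inj_card_eq Tinj)).
apply: sub_finite_set fin_classes => _ [p Pp <-] /=.
by exists (T p) => //; case: (TP p Pp).
Qed.
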